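(* Let $S=2\cdot 2^{\alpha_0-1}p_1^{\alpha_1}p_2^{\alpha_2}\cdots p_r^{\alpha_r}$ be a positive even integer, where $\alpha_0\ge 1$, $r\ge 0$, $p_1,\dots,p_r$ are distinct odd primes and $\alpha_1,\dots,\alpha_r\ge 1$. Let $L(S)$ be the number of ways to represent the area $S^2$ of a square of side $S$ as the total area of two equal rectangles with relatively prime integer sides, i.e. the number of unordered pairs $\{u,v\}$ of relatively prime positive integers with $2uv=S^2$. Then $$L(S)=\sum_{j=0}^{r}\binom{r}{j}=2^r .$$
   Context: The square of even side $S$ is called the generating square. The number $r$ is the number of distinct odd primes dividing $S$ (prime factors counted without their powers). *)

(* Defs.v *)
From mathcomp Require Import all_boot.

Set Implicit Arguments.
Unset Strict Implicit.
Unset Printing Implicit Defensive.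

Definition two_rect_rep (S u v : nat) : bool :=
  [&& 0 < u, 0 < v, coprime u v & 2 * (u * v) == S ^ 2].

(* An unordered pair {u, v} is the finite set [set u; v]. The carrier
   {0, .., S^2} only serves to have a finite type: by [two_rect_rep_bound] it
   excludes no pair. *)
Definition two_rect_reps (S : nat) : {set {set 'I_(S ^ 2).+1}} :=
  [set [set uv.1; uv.2] | uv : 'I_(S ^ 2).+1 * 'I_(S ^ 2).+1
                        & two_rect_rep S uv.1 uv.2].

Definition L (S : nat) : nat := #|two_rect_reps S|.

Lemma two_rect_rep_bound (S u v : nat) :
  two_rect_rep S u v -> (u <= S ^ 2) && (v <= S ^ 2).
Proof.
case/and4P=> u_gt0 v_gt0 _ /eqP <-; apply/andP; split.
  by rewrite mulnCA leq_pmulr // muln_gt0.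
by rewrite mulnA leq_pmull // muln_gt0.
Qed.

(* Main.v *)
Require Import Defs.
From mathcomp Require Import all_boot.

(** Exactly one of [u], [v] is odd, so an unordered pair is determined by its odd
    member [u]. Since [u] and [v] are coprime, each odd prime power of [S ^ 2]
    goes entirely to [u] or to [v], hence the pairs correspond to the subsets of
    the [r] odd primes. *)

Set Implicit Arguments.
Unset Strict Implicit.

Section PrimePowerProducts.

Variables (r : nat) (p a : 'I_r -> nat).
Hypotheses (p_prime : forall i, prime (p i)) (p_inj : injective p).
Hypothesis a_gt0 : forall i, 0 < a i.

Definition prod_pow (A : {set 'I_r}) : nat := \prod_(i in A) p i ^ a i.

Lemma prod_pow_gt0 A : 0 < prod_pow A.
Proof. by apply: prodn_gt0 => i; rewrite expn_gt0 prime_gt0. Qed.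

Lemma prod_powC A : prod_pow A * prod_pow (~: A) = \prod_i p i ^ a i.
Proof.
rewrite [RHS](bigID (mem A)) /=; congr (_ * _).
by apply: eq_bigl => i; rewrite inE.
Qed.

Lemma coprime_prod_pow (A : {set 'I_r}) n :
  (forall i, i \in A -> ~~ (p i %| n)) -> coprime (prod_pow A) n.
Proof.
move=> nA; rewrite /prod_pow.
elim/big_ind: _ => [|x y cx cy|i iA]; first exact: coprime1n.
  by rewrite coprimeMl cx.
by rewrite coprimeXl // prime_coprime // nA.
Qed.

(** Allows a subset to be recovered from its product. *)
Lemma dvd_prod_pow (A : {set 'I_r}) i : (p i %| prod_pow A) = (i \in A).
Proof.
case: (boolP (i \in A)) => iA.
  by rewrite /prod_pow (bigD1 i) //= dvdn_mulr // dvdn_exp.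
apply/negbTE; rewrite -prime_coprime // coprime_sym coprime_prod_pow // => j jA.
rewrite dvdn_prime2 //; apply: contraNneq iA => /p_inj <-; exact: jA.
Qed.

Lemma prod_pow_inj : injective prod_pow.
Proof. by move=> A B eAB; apply/setP=> i; rewrite -!dvd_prod_pow eAB. Qed.

Lemma odd_prod_pow A : (forall i, odd (p i)) -> odd (prod_pow A).
Proof.
move=> p_odd; rewrite /prod_pow.
elim/big_ind: _ => // [x y ox oy|i _]; first by rewrite oddM ox.
by rewrite oddX p_odd orbT.
Qed.

(** Gauss's lemma gives divisibility both ways: [u] is coprime to [2 ^ k] and to the prime powers
    outside the set, while those inside are coprime to [v] because their primes already divide
    [u]. *)
Lemma coprime_factor_prod_pow k u v :
    odd u -> coprime u v -> u * v = 2 ^ k * \prod_i p i ^ a i ->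
  u = prod_pow [set i | p i %| u].
Proof.
move=> ou cuv; set A := [set i | _]; rewrite -(prod_powC A) => uv.
apply/eqP; rewrite eqn_dvd; apply/andP; split.
  have cu2 : coprime u (2 ^ k) by rewrite coprimeXr // coprimen2.
  have cuC : coprime u (prod_pow (~: A)).
    by rewrite coprime_sym coprime_prod_pow // => i; rewrite !inE.
  by rewrite -(Gauss_dvdl _ cuC) -(Gauss_dvdr _ cu2) -uv dvdn_mulr.
have cAv : coprime (prod_pow A) v.
  apply: coprime_prod_pow => i; rewrite inE => pu; rewrite -prime_coprime //.
  exact: coprime_dvdl pu cuv.
by rewrite -(Gauss_dvdl _ cAv) uv dvdn_mull // dvdn_mulr.
Qed.

End PrimePowerProducts.

Lemma two_rect_rep_sym S u v : two_rect_rep S u v = two_rect_rep S v u.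
Proof.
by rewrite /two_rect_rep coprime_sym (mulnC u); do 2!case: (0 < _).
Qed.

Section CountRepresentations.

Variables (S r k : nat) (p a : 'I_r -> nat).
Hypotheses (p_prime : forall i, prime (p i)) (p_odd : forall i, odd (p i)).
Hypotheses (p_inj : injective p) (a_gt0 : forall i, 0 < a i) (k_gt0 : 0 < k).
(** Here [k] and [a] are the exponents of half the area, not of the side [S]; the leading 2 cancels
    against the two equal rectangles. *)
Hypothesis S2E : S ^ 2 = 2 * (2 ^ k * \prod_i p i ^ a i).

Let odd_side A := prod_pow p a A.
Let even_side A := 2 ^ k * prod_pow p a (~: A).
Let side_pair (A : {set 'I_r}) : {set 'I_(S ^ 2).+1} :=
  [set inord (odd_side A); inord (even_side A)].

Lemma sides_rep A : two_rect_rep S (odd_side A) (even_side A).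
Proof.
rewrite /two_rect_rep /odd_side /even_side muln_gt0 expn_gt0 !prod_pow_gt0 //=.
rewrite coprimeMr coprimeXr ?coprimen2 ?odd_prod_pow //= S2E.
rewrite (mulnCA _ (2 ^ k)) prod_powC eqxx andbT.
apply: coprime_prod_pow => // i iA.
by rewrite dvd_prod_pow // inE iA.
Qed.

(** Since [inord] sends out-of-range values to the default 0, these bounds are what let the sides be
    read back from [side_pair]. *)
Lemma sides_bound A : (odd_side A < (S ^ 2).+1) * (even_side A < (S ^ 2).+1).
Proof. by have /andP[] := two_rect_rep_bound (sides_rep A); rewrite !ltnS. Qed.

Lemma side_pair_inj : injective side_pair.
Proof.
move=> A B eAB; apply: (prod_pow_inj p_prime p_inj a_gt0).
have: inord (odd_side A) \in side_pair B by rewrite -eAB !inE eqxx.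
rewrite !inE => /orP[] /eqP /(congr1 val) /=; rewrite !inordK ?sides_bound //.
(* The remaining case equates the odd side of [A] with the even side of [B]; parity excludes it, as
   [k] is positive. *)
move=> /(congr1 odd); rewrite oddM oddX orbF eqn0Ngt k_gt0 /=.
by rewrite odd_prod_pow.
Qed.

Lemma rep_side_pair (u v : 'I_(S ^ 2).+1) :
  odd u -> two_rect_rep S u v -> exists A, [set u; v] = side_pair A.
Proof.
move=> ou /and4P[u_gt0 _ cuv]; rewrite [eqbRHS]S2E eqn_pmul2l // => /eqP uv.
have uE := coprime_factor_prod_pow p_prime ou cuv uv.
exists [set i | p i %| u]; set A := [set i | _] in uE *.
have vE : v = even_side A :> nat.
  (* Cancelling [u] from the product leaves [2 ^ k] and the complementary prime powers. *)
  apply/eqP; rewrite -(eqn_pmul2l u_gt0) uv {1}uE /even_side mulnCA.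
  by rewrite prod_powC.
by rewrite /side_pair /odd_side -uE -vE !inord_val.
Qed.

Lemma two_rect_repsE : two_rect_reps S = side_pair @: setT.
Proof.
apply/setP=> X; apply/imsetP/imsetP => [[[u v]] /= | [A _ ->]].
  rewrite inE /= => rep ->.
  have [A ->] : exists A, [set u; v] = side_pair A; last by exists A.
  case: (boolP (odd u)) => [ou | eu]; first exact: rep_side_pair.
  (* If [u] is even, coprimality forces [v] to be odd, so the roles are swapped. *)
  rewrite setUC; apply: rep_side_pair; last by rewrite two_rect_rep_sym.
  case/and4P: rep => _ _ cuv _; rewrite -coprime2n.
  by apply: coprime_dvdl cuv; rewrite dvdn2.
exists (inord (odd_side A), inord (even_side A)) => //=.
by rewrite inE /= !inordK ?sides_bound ?sides_rep.
Qed.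

Lemma L_pow2 : L S = 2 ^ r.
Proof.
rewrite /L two_rect_repsE card_imset; last exact: side_pair_inj.
by rewrite -powersetT card_powerset cardsT card_ord.
Qed.

End CountRepresentations.

Theorem theorem1p2 (S r a0 : nat) (p a : 'I_r -> nat)
    (ha0 : 1 <= a0)
    (p_prime : forall i, prime (p i))
    (p_odd : forall i, odd (p i))
    (p_inj : injective p)
    (ha : forall i, 1 <= a i)
    (hS : S = 2 * 2 ^ (a0 - 1) * \prod_(i < r) p i ^ a i) :
  L S = \sum_(0 <= j < r.+1) 'C(r, j) /\
  \sum_(0 <= j < r.+1) 'C(r, j) = 2 ^ r.
Proof.
have sum_bin : \sum_(0 <= j < r.+1) 'C(r, j) = 2 ^ r.
  (* Binomial expansion of [(1 + 1) ^ r]. *)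
  rewrite big_mkord (expnDn 1 1).
  by apply: eq_bigr => j _; rewrite !exp1n !muln1.
split=> //; rewrite sum_bin.
(* Squaring doubles every exponent: [S ^ 2] contains 2 to the power [2 * (a0 - 1) + 2], and halving
   the area removes one factor 2. *)
apply: (@L_pow2 S r (a0 - 1).*2.+1 p (fun i => (a i).*2)) => // [i|].
  by rewrite double_gt0 ha.
have -> : \prod_i p i ^ (a i).*2 = (\prod_i p i ^ a i) ^ 2.
  elim/big_rec2: _ => [//|i x y _ ->].
  by rewrite expnMn -expnM muln2.
by rewrite hS !expnMn (expnS _ _.*2) -[(a0 - 1).*2]muln2 expnM !mulnA.
Qed.
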